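(* Let $\delta\ge 2$ be an integer and let $G$ be a connected graph of even order $n$ with minimum degree $\delta$, where $n\ge \max\{7\delta-7,\ \tfrac14\delta^2+\tfrac12\delta+6\}$. If $$\rho_Q(G)\ \ge\ \rho_Q\big(K_\delta\vee(K_{n-2\delta+1}\cup(\delta-1)K_1)\big),$$ then $G$ contains an even factor, unless $G\cong K_\delta\vee(K_{n-2\delta+1}\cup(\delta-1)K_1)$.
   Context: All graphs are finite, simple and undirected. An even factor of a graph $G$ is a spanning subgraph $F$ of $G$ such that $d_F(v)$ is a nonzero even number for every vertex $v\in V(G)$. The signless Laplacian matrix is $Q(G)=A(G)+D(G)$, where $A(G)$ is the adjacency matrix and $D(G)$ the diagonal matrix of vertex degrees; $\rho_Q(G)$ denotes the largest eigenvalue of $Q(G)$. $K_m$ is the complete graph on $m$ vertices, $G_1\cup G_2$ is the disjoint union, $tK_1$ is the edgeless graph on $t$ vertices, and $G_1\vee G_2$ (join) is obtained from $G_1\cup G_2$ by adding all edges between $V(G_1)$ and $V(G_2)$. *)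

(* Defs.v *)
From HB Require Import structures.
From mathcomp Require Import all_boot all_order all_algebra.
From mathcomp Require Import reals.
Set Implicit Arguments. Unset Strict Implicit. Unset Printing Implicit Defensive.
Import Order.TTheory GRing.Theory Num.Theory.

Definition simple_graph (n : nat) (g : rel 'I_n) : Prop :=
  symmetric g /\ irreflexive g.

Definition deg (n : nat) (g : rel 'I_n) (v : 'I_n) : nat := #|[set w | g v w]|.

Definition min_degree (n : nat) (g : rel 'I_n) (delta : nat) : Prop :=
  (exists v, deg g v = delta) /\ (forall v, delta <= deg g v).

Definition connected_graph (n : nat) (g : rel 'I_n) : Prop :=
  forall x y : 'I_n, connect g x y.

Definition has_even_factor (n : nat) (g : rel 'I_n) : Prop :=
  exists F : rel 'I_n,
    symmetric F /\ (forall x y, F x y -> g x y) /\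
    (forall v, 0 < deg F v /\ ~~ odd (deg F v)).

Definition isomorphic (n : nat) (g h : rel 'I_n) : Prop :=
  exists f : 'I_n -> 'I_n, bijective f /\ forall x y, g x y = h (f x) (f y).

Definition signlessQ (R : realType) (n : nat) (g : rel 'I_n) : 'M[R]_n :=
  \matrix_(i, j) ((g i j)%:R + (i == j)%:R * (deg g i)%:R)%R.

Definition is_rhoQ (R : realType) (n : nat) (g : rel 'I_n) (r : R) : Prop :=
  eigenvalue (signlessQ R g) r /\
  (forall e : R, eigenvalue (signlessQ R g) e -> (e <= r)%R).

(* K_d \/ (K_{n-2d+1} U (d-1)K_1) on 'I_n: vertices < d form K_d,
   vertices in [d, n-d+1) form K_{n-2d+1}, vertices >= n-d+1 are the
   (d-1) isolated vertices of the second part. *)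
Definition extremal_graph (n d : nat) : rel 'I_n :=
  fun i j => (i != j) &&
    [|| (i < d)%N, (j < d)%N | ((i < n - d + 1) && (j < n - d + 1))%N].
Arguments extremal_graph : clear implicits.

(* Main.v *)
(* If rho_Q(G) >= rho_Q(H), then rho_Q(G) >= 2(n - delta), because H contains
   K_(n-delta+1). On the other hand rho_Q(G) is at most d(v) plus the mean degree
   of the neighbours of v, for some v; hence, with D = delta - 1, G has at most
   (n-1)D non-edges.
   Take a set C maximising 2 e(C) - |C|^2/2 - |C|, where e counts edges: C
   contains more than half of the vertices, and every vertex of C is adjacent to
   more than half of C. Call u coverable if every even subgraph F can be replaced
   by an even subgraph that covers u and everything covered by F. If F misses u,
   adding modulo 2 a closed walk through u can uncover only vertices other than u
   and its two neighbours on the walk. Triangles, then 4-cycles, then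
   longer walks through C show that the following are coverable: C; the set R of
   the vertices with two neighbours in C; each v with two neighbours in N(R).
   If some v is not coverable, then A = N(v) - N(R) has at least D elements, and
   for a in A the sets A and N(a) are disjoint, as v lies on no triangle. So
   their union consists of at least 2D+1 vertices, all with at most one neighbour
   in C: this is too many non-edges. Hence everything is coverable and G always
   has an even factor, H included. *)
Require Import Defs.
From HB Require Import structures.
From mathcomp Require Import all_boot all_order all_algebra.
From mathcomp Require Import reals.
From mathcomp Require Import zify ring lra.
Import Order.TTheory GRing.Theory Num.Theory.
Set Implicit Arguments. Unset Strict Implicit. Unset Printing Implicit Defensive.

(** * The inequality behind the size of the dense core *)

(** [S] and [e] stand for the degree sums of the whole graph and of the maximising set, whose size
    is [c]; the last hypothesis compares that set with the set of all vertices. *)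
Lemma core_size_bound n D c e S : 0 < D -> 8 <= n -> 7 * D <= n -> c <= n ->
  n.-1 * (n - 2 * D) <= S -> e <= c * c.-1 ->
  2 * S <= 2 * e + (n * (n + 2) - c * (c + 2)) -> n < 2 * c.
Proof.
move=> D0 n8 nD cn degs ec Cmax; rewrite ltnNge; apply/negP => c_small.
have p1 : 4 * (c * c) + 8 * n <= n * n + 16 * c.
  have [j n_eq] : exists j, n = 2 * c + j by exists (n - 2 * c); lia.
  have : j * 8 <= j * (4 * c + j) by rewrite leq_mul2l; apply/orP; right; lia.
  by rewrite n_eq; lia.
have p2 : 7 * (D * n.-1) <= n * n.-1 by rewrite mulnA leq_mul2r nD orbT.
have p3 : n.-1 * (n - 2 * D) = n.-1 * n - 2 * (D * n.-1).
  by rewrite mulnBr mulnCA [n.-1 * D]mulnC.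
have p4 : c * c.-1 + c = c * c by case: (c) => //= q; lia.
have p5 : c * (c + 2) <= n * (n + 2) by apply: leq_mul; lia.
(* With [2c <= n] and [7D <= n] the estimates give [10n(n-1)/7 <= 5n^2/4], so [n <= 8]. The boundary
   case [n = 8] is excluded because the integer [D] is then 1, below [n/7]. *)
have [n_eq|n9] : n = 8 \/ 9 <= n by lia.
  have D1 : D = 1 by lia.
  by subst D n; lia.
have p6 : 9 * n <= n * n by rewrite leq_mul2r n9 orbT.
case: n => // q in n8 nD cn degs Cmax c_small p1 p2 p3 p5 n9 p6 *.
lia.
Qed.

(** * Parity of degrees under sums modulo 2 *)

Lemma odd_degE (n : nat) (F : rel 'I_n) v :
  odd (deg F v) = \big[addb/false]_w F v w.
Proof.
rewrite /deg -sum1_card (big_morph odd oddD (erefl _)) big_mkcond /=.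
by apply: eq_bigr => w _; rewrite inE; case: (F v w).
Qed.

Definition rel_xor (T : Type) (F Z : rel T) : rel T := fun x y => F x y (+) Z x y.

Definition edge (T : eqType) (a b : T) : rel T :=
  fun x y => (x == a) && (y == b) || (x == b) && (y == a).

(** Edges traversed twice cancel, so walks may repeat vertices and edges; only the two ends can get
    odd degree. *)
Fixpoint walk_sum (T : eqType) (a : T) (p : seq T) : rel T :=
  if p is b :: q then rel_xor (edge a b) (walk_sum b q) else fun _ _ => false.

Lemma walk_sum_out (T : eqType) (a x y : T) p :
  x \notin a :: p -> walk_sum a p x y = false.
Proof.
elim: p a => [//|b p IHp] a; rewrite inE negb_or => /andP[xa xp].
rewrite /= /rel_xor IHp // /edge (negPf xa) /=.
by move: xp; rewrite inE negb_or => /andP[/negPf-> _].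
Qed.

Section Graph.
Variables (n : nat) (g : rel 'I_n).
Hypotheses (gS : symmetric g) (gI : irreflexive g).

Definition even_subgraph (F : rel 'I_n) :=
  [/\ symmetric F, subrel F g & forall v, ~~ odd (deg F v)].

Definition covers (F : rel 'I_n) (v : 'I_n) := exists w, F v w.

Definition coverable (u : 'I_n) := forall F, even_subgraph F ->
  exists F', [/\ even_subgraph F', forall v, covers F v -> covers F' v & covers F' u].

Lemma edge_sym (a b : 'I_n) : symmetric (edge a b).
Proof. by move=> x y; rewrite /edge orbC [(y == b) && _]andbC [(y == a) && _]andbC. Qed.

Lemma sub_edge (a b : 'I_n) : g a b -> subrel (edge a b) g.
Proof. by move=> gab x y /orP[] /andP[/eqP-> /eqP->] //; rewrite gS. Qed.

Lemma odd_deg_xor (F Z : rel 'I_n) v :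
  odd (deg (rel_xor F Z) v) = odd (deg F v) (+) odd (deg Z v).
Proof. by rewrite !odd_degE -big_split. Qed.

Lemma sub_xor (F Z : rel 'I_n) : subrel F g -> subrel Z g -> subrel (rel_xor F Z) g.
Proof.
move=> FG ZG x y; rewrite /rel_xor.
by case: (boolP (F x y)) => [/FG//|_]; case: (boolP (Z x y)) => [/ZG|].
Qed.

Lemma sym_xor (F Z : rel 'I_n) : symmetric F -> symmetric Z -> symmetric (rel_xor F Z).
Proof. by move=> FS ZS x y; rewrite /rel_xor FS ZS. Qed.

Lemma odd_deg_edge (a b v : 'I_n) : a != b -> odd (deg (edge a b) v) = (v == a) (+) (v == b).
Proof.
move=> ab; rewrite /deg /edge.
have card_eq (c : 'I_n) : #|[set w | w == c]| = 1 by rewrite -(cards1 c); apply: eq_card => w; rewrite !inE.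
have [->|va] := eqVneq v a.
  rewrite (negPf ab) -[true (+) _]/(odd 1) -(card_eq b); congr (odd _).
  by apply: eq_card => w; rewrite !inE orbF.
have [_|vb] := eqVneq v b; last by rewrite /= cards0.
rewrite -[_ (+) _]/(odd 1) -(card_eq a); congr (odd _).
Qed.

Lemma walk_sum_sym (a : 'I_n) p : symmetric (walk_sum a p).
Proof. by elim: p a => [//|b p IHp] a /=; apply: sym_xor => //; apply: edge_sym. Qed.

Lemma sub_walk_sum (a : 'I_n) p : path g a p -> subrel (walk_sum a p) g.
Proof.
elim: p a => [//|b p IHp] a /= /andP[gab gp].
by apply: sub_xor (IHp _ gp); apply: sub_edge.
Qed.

Lemma adj_neq x y : g x y -> x != y.
Proof. by apply: contraTneq => ->; rewrite gI. Qed.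

Lemma odd_deg_walk_sum (a v : 'I_n) p : path g a p ->
  odd (deg (walk_sum a p) v) = (v == a) (+) (v == last a p).
Proof.
elim: p a => [|b p IHp] a /=.
  by move=> _; rewrite addbb odd_degE big1.
case/andP=> gab gp; rewrite odd_deg_xor IHp // odd_deg_edge ?adj_neq //.
by rewrite addbA -[X in X (+) _]addbA addbb addbF.
Qed.

(** * Coverable vertices *)

(** The vertices can be treated one at a time, since no step uncovers what earlier steps covered. *)
Lemma coverable_seq (s : seq 'I_n) : (forall u, u \in s -> coverable u) ->
  forall F, even_subgraph F ->
  exists F', [/\ even_subgraph F', forall v, covers F v -> covers F' v
    & forall u, u \in s -> covers F' u].
Proof.
elim: s => [|u s IHs] cs F eF; first by exists F.
have [v vs|F1 [eF1 sub1 cov1]] := IHs _ F eF; first by apply: cs; rewrite inE vs orbT.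
have [F2 [eF2 sub2 cov2]] := cs u (mem_head _ _) F1 eF1.
exists F2; split=> // [v /sub1/sub2//|v].
by rewrite inE => /orP[/eqP->//|/cov1/sub2].
Qed.

(* If F misses u, adding the closed walk mod 2 covers u, and keeps its two
   neighbours covered since F has no edge at u; only vertices of p can be lost. *)
Lemma coverable_closed_walk u a b p :
  a != b -> g u a -> g u b -> path g a (rcons p b) -> u \notin p ->
  (forall x, x \in p -> coverable x) -> coverable u.
Proof.
move=> ab gua gub gp up cp F eF.
have [/existsP[w Fw]|/existsPn uncov] := boolP [exists w, F u w].
  by exists F; split=> //; exists w.
have [FS FG Feven] := eF.
pose W := walk_sum a (rcons p b).
pose Z := rel_xor (rel_xor (edge u a) W) (edge u b).
have ZS : symmetric Z.
  by apply: sym_xor (edge_sym u b); apply: sym_xor (edge_sym u a) (walk_sum_sym _ _).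
have eZ : even_subgraph Z.
  split=> // [|v].
    apply: sub_xor (sub_edge gub).
    by apply: sub_xor (sub_edge gua) (sub_walk_sum gp).
  rewrite !odd_deg_xor odd_deg_walk_sum // !odd_deg_edge ?adj_neq // last_rcons.
  by case: (v == u); case: (v == a); case: (v == b).
have ua := adj_neq gua; have ub := adj_neq gub.
(* The walk [W] avoids [u], so the edges from [u] to [a] and to [b] survive in [Z]. *)
have Wu y : W u y = false.
  by apply: walk_sum_out; rewrite inE negb_or ua mem_rcons inE negb_or ub.
have Zua : Z u a.
  by rewrite /Z /rel_xor Wu /edge !eqxx (negPf ab) (negPf ub) [a == u]eq_sym (negPf ua).
have Zub : Z u b.
  rewrite /Z /rel_xor Wu /edge !eqxx [b == a]eq_sym (negPf ab).
  by rewrite (negPf ua) [b == u]eq_sym (negPf ub).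
have Fu y : F u y = false by apply/negbTE/uncov.
have eF1 : even_subgraph (rel_xor F Z).
  case: eZ => _ ZG Zeven; split; [exact: sym_xor|exact: sub_xor|].
  by move=> v; rewrite odd_deg_xor (negPf (Feven v)) (negPf (Zeven v)).
have [F2 [eF2 sub2 cov2]] := coverable_seq cp eF1.
exists F2; split=> // [v [w Fvw]|]; last first.
  by apply: sub2; exists a; rewrite /rel_xor Fu Zua.
have [vp|vp] := boolP (v \in p); first exact: cov2.
apply: sub2; have [->|va] := eqVneq v a; first by exists u; rewrite /rel_xor FS Fu ZS Zua.
have [->|vb] := eqVneq v b; first by exists u; rewrite /rel_xor FS Fu ZS Zub.
have vu : v != u by apply: contraTneq Fvw => ->; rewrite Fu.
exists w; rewrite /rel_xor Fvw /Z /rel_xor /edge (negPf vu) (negPf va) (negPf vb) /W.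
by rewrite walk_sum_out // inE negb_or va mem_rcons inE negb_or vb.
Qed.

(** The empty subgraph is even, and serves as the starting point. *)
Lemma even_factor_of_coverable : (forall u, coverable u) -> has_even_factor g.
Proof.
move=> cov; have [|F [[FS FG Fe] _ Fc]] := @coverable_seq (enum 'I_n) (fun u _ => cov u) (fun _ _ => false).
  by split=> // v; rewrite odd_degE big1.
exists F; split=> //; split=> // v; split; last exact: Fe.
by have [|w Fw] := Fc v; rewrite ?mem_enum // card_gt0; apply/set0Pn; exists w; rewrite inE.
Qed.

(** * The dense core and the count of non-edges *)

Local Notation N v := [set w | g v w].

Lemma card_nbrs_setD1 (C : {set 'I_n}) v x : v \in C ->
  #|N x :&: C| = #|N x :&: (C :\ v)| + g x v.
Proof.
move=> vC; rewrite (cardsD1 v (N x :&: C)) addnC !inE vC andbT; congr (_ + _).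
by apply: eq_card => w; rewrite !inE; case: (w == v); rewrite ?andbF.
Qed.

Lemma sum_nbrs_setD1 (C : {set 'I_n}) v : v \in C ->
  \sum_(x in C) #|N x :&: C| = \sum_(x in C :\ v) #|N x :&: (C :\ v)| + 2 * #|N v :&: C|.
Proof.
move=> vC; rewrite (big_setD1 v vC) /=.
under eq_bigr do rewrite (card_nbrs_setD1 _ vC).
rewrite big_split /=.
suff -> : \sum_(i in C :\ v) g i v = #|N v :&: C| by rewrite addnCA mul2n addnn.
rewrite -sum1_card big_mkcond [RHS]big_mkcond /=; apply: eq_bigr => x _.
rewrite !inE gS; have [->|_] /= := eqVneq x v; first by rewrite gI.
by rewrite andbC; case: (x \in C); case: (g v x).
Qed.

Lemma dense_core D : 0 < D -> 8 <= n -> 7 * D <= n ->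
  n.-1 * (n - 2 * D) <= \sum_v deg g v ->
  exists2 C : {set 'I_n}, n < 2 * #|C| & forall v, v \in C -> #|C| < 2 * #|N v :&: C|.
Proof.
move=> D0 n8 nD degs.
(* The offset n * (n + 2) makes the truncated subtraction exact. *)
pose f (C : {set 'I_n}) := 2 * (\sum_(x in C) #|N x :&: C|) + (n * (n + 2) - #|C| * (#|C| + 2)).
have card_le (C : {set 'I_n}) : #|C| <= n by rewrite -[X in _ <= X]card_ord max_card.
have [C _ Cmax] := @arg_maxnP _ setT xpredT f isT.
exists C => [|v vC].
  have /= := Cmax setT isT; rewrite /f cardsT card_ord.
  have -> : \sum_(x in setT) #|N x :&: setT| = \sum_x deg g x.
    by apply: eq_big => [x|x _]; rewrite ?inE // setIT.
  have : \sum_(x in C) #|N x :&: C| <= #|C| * #|C|.-1.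
    rewrite -sum_nat_const; apply: leq_sum => x xC.
    have -> : #|C|.-1 = #|C :\ x| by rewrite (cardsD1 x C) xC.
    apply: subset_leq_card; apply/subsetP => w; rewrite !inE => /andP[gxw ->].
    by rewrite eq_sym adj_neq.
  by move=> e_le max_le; apply: (core_size_bound D0 n8 nD (card_le C) degs e_le); lia.
(* Deleting [v] cannot increase [f]: with [|C| = c + 1] this reads [4m >= 2c + 3], hence
   [2m > c + 1]. *)
have := Cmax (C :\ v) isT; rewrite /= /f (sum_nbrs_setD1 vC) (cardsD1 v C) vC.
have := card_le C; rewrite (cardsD1 v C) vC.
set c := #|C :\ v|; set e := \sum_(x in _) _; set m := #|N v :&: C|.
nia.
Qed.

(** Two subsets of [C], each larger than half of it, must meet. The case [a = b] is included. *)
Lemma common_nbr (C : {set 'I_n}) : (forall v, v \in C -> #|C| < 2 * #|N v :&: C|) ->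
  forall a b, a \in C -> b \in C -> exists2 x, x \in C & g a x && g b x.
Proof.
move=> coreC a b aC bC.
have : 0 < #|(N a :&: C) :&: (N b :&: C)|.
  have sub : #|(N a :&: C) :|: (N b :&: C)| <= #|C|.
    by apply/subset_leq_card/subsetP => w; rewrite !inE => /orP[] /andP[].
  have := cardsUI (N a :&: C) (N b :&: C); have := coreC a aC; have := coreC b bC.
  lia.
by case/card_gt0P => x; rewrite !inE => /andP[/andP[gax xC] /andP[gbx _]]; exists x; rewrite ?gax.
Qed.

(** Among the [n * n] ordered pairs, the adjacent pairs, the diagonal, and the non-adjacent pairs
    from [Y] to [C] and from [C] to [Y] are disjoint classes; each vertex of [Y] misses at least
    [|C| - 1] vertices of [C]. *)
Lemma nonedge_count (Y C : {set 'I_n}) : [disjoint Y & C] ->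
  (forall y, y \in Y -> #|N y :&: C| <= 1) ->
  \sum_v deg g v + 2 * (#|Y| * #|C|.-1) + n <= n * n.
Proof.
move=> YC Ysparse.
pose e v w : nat := (v \in Y) && (w \in C) && ~~ g v w.
have count : #|Y| * #|C|.-1 <= \sum_v \sum_w e v w.
  rewrite -sum_nat_const big_mkcond; apply: leq_sum => v _.
  case: ifP => // vY; have -> : \sum_w e v w = #|C :\: N v|.
    rewrite -sum1_card [RHS]big_mkcond; apply: eq_bigr => w _.
    by rewrite /e vY /= !inE andbC; case: (_ && _).
  by rewrite -subn1 leq_subLR -(cardsID (N v) C) setIC leq_add2r Ysparse.
have -> : \sum_v deg g v = \sum_v \sum_w g v w.
  apply: eq_bigr => v _; rewrite /deg -sum1_card big_mkcond.
  by apply: eq_bigr => w _; rewrite inE; case: (g v w).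
have diag : n = \sum_(v < n) \sum_(w < n) (v == w).
  rewrite -[LHS]card_ord -sum1_card; apply: eq_bigr => v _.
  rewrite (bigD1 v) //= eqxx big1 ?addn0 // => w wv.
  by rewrite eq_sym (negPf wv).
have square : n * n = \sum_(v < n) \sum_(w < n) 1.
  by rewrite !sum_nat_const !card_ord muln1.
rewrite square [X in _ + X <= _]diag.
suff : \sum_v \sum_w g v w + (\sum_v \sum_w e v w + \sum_v \sum_w e w v)
   + \sum_(v < n) \sum_(w < n) (v == w) <= \sum_(v < n) \sum_(w < n) 1.
  rewrite [X in _ + (_ + X)]exchange_big; apply: leq_trans.
  by rewrite leq_add2r leq_add2l mul2n -addnn leq_add.
rewrite -!big_split; apply: leq_sum => v _ /=; rewrite -!big_split; apply: leq_sum => w _ /=.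
have disj x : (x \in Y) && (x \in C) = false.
  by have [xY|//] := boolP (x \in Y); rewrite (disjointFr YC xY).
rewrite /e [g w v]gS; have [->|_] := eqVneq v w; first by rewrite gI disj.
have := disj v; case: (g v w) => /=; rewrite ?andbF ?andbT //.
by case: (v \in Y) (v \in C) (w \in Y) (w \in C) => [] [] [] [].
Qed.

(** * Even factors of dense graphs *)

Lemma even_factor_of_dense D : 0 < D -> 8 <= n -> 7 * D <= n ->
  (forall v, D < deg g v) -> n.-1 * (n - 2 * D) <= \sum_v deg g v ->
  has_even_factor g.
Proof.
move=> D0 n8 nD mindeg degs.
have [C Cn coreC] := dense_core D0 n8 nD degs.
have common := common_nbr coreC.
have covC u : u \in C -> coverable u.
  move=> uC; have : 0 < #|N u :&: C| by have := coreC u uC; lia.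
  case/card_gt0P => a; rewrite !inE => /andP[gua aC].
  have [b bC /andP[gub gab]] := common u a uC aC.
  by apply: (@coverable_closed_walk u a b [::]) => //=; rewrite ?gab ?adj_neq.
pose R := [set u | 1 < #|N u :&: C|].
have coverR u : u \in R -> coverable u.
  rewrite inE => /card_gt1P[a [b [+ + ab]]]; rewrite !inE.
  case/andP=> gua aC /andP[gub bC].
  have [uC|uC] := boolP (u \in C); first exact: covC.
  have [x xC /andP[gax gbx]] := common a b aC bC.
  apply: (@coverable_closed_walk u a b [:: x]) => //=.
  - by rewrite gax gS gbx.
  - by rewrite inE; apply: contraNneq uC => ->.
  - by move=> y; rewrite inE => /eqP->; apply: covC.
have subCR : {subset C <= R}.
  by move=> u uC; rewrite inE; have := coreC u uC; lia.
have Rnbr r : r \in R -> exists2 c, c \in C & g r c.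
  rewrite inE => /ltnW/card_gt0P[c]; rewrite !inE => /andP[grc cC].
  by exists c.
pose NR := [set u | [exists r in R, g u r]].
have coverNR v a b : a != b -> g v a -> g v b -> a \in NR -> b \in NR -> coverable v.
  rewrite !inE => ab gva gvb /exists_inP[r rR gar] /exists_inP[s sR gbs].
  have [vR|vR] := boolP (v \in R); first exact: coverR.
  have [c cC grc] := Rnbr r rR; have [d dC gsd] := Rnbr s sR.
  have [x xC /andP[gcx gdx]] := common c d cC dC.
  have /allP sub : all (mem R) [:: r; c; x; d; s] by rewrite /= rR sR !subCR.
  (* All inner vertices lie in [R], so they are coverable and differ from [v]; they may repeat, for
     instance when [r = s]. *)
  apply: (@coverable_closed_walk v a b [:: r; c; x; d; s]) => //=.
  - by rewrite gar grc gcx [g x d]gS gdx [g d s]gS gsd [g s b]gS gbs.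
  - by apply: contra vR => /sub.
  - by move=> y /sub; apply: coverR.
apply: even_factor_of_coverable => v.
have [/card_gt1P[a [b [+ + ab]]]|few] := ltnP 1 #|N v :&: NR|.
  rewrite [a \in _]inE [b \in _]inE ![_ \in N v]inE => /andP[gva aR] /andP[gvb bR].
  exact: (coverNR v a b).
pose A := N v :\: NR.
have cardA : D <= #|A|.
  by have := cardsID NR (N v); have := mindeg v; rewrite /deg -/A; lia.
have /card_gt0P[a aA] : 0 < #|A| by lia.
have [[gva]] : g v a /\ a \notin NR by move: aA; rewrite inE inE => /andP[].
have far x r : x \notin NR -> g x r -> r \notin R.
  move=> xNR gxr; apply: contra xNR => rR; rewrite inE; apply/exists_inP; by exists r.
move=> aNR.
(* A common element [b] of [A] and [N a] would form a triangle with [v] and [a]. *)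
have [/pred0P disj|/pred0Pn[b]] := boolP [disjoint A & N a]; last first.
  rewrite /= [b \in A]inE [b \in N a]inE => /andP[/andP[_ gvb] gab].
  rewrite inE in gvb.
  by apply: (@coverable_closed_walk v a b [::]) => //=; rewrite ?gab ?adj_neq.
pose Y := A :|: N a.
have cardY : 2 * D < #|Y|.
  have := mindeg a; rewrite /deg /Y cardsU.
  have -> : A :&: N a = set0 by apply/setP => b; rewrite !inE; have := disj b; rewrite /= !inE.
  rewrite cards0; lia.
(* Neighbours of [a] avoid [R] because [a] is not in [NR]. A member of [A] in [R] would have a
   neighbour in [C], hence in [R], and so lie in [NR]. *)
have sparse y : y \in Y -> y \notin R.
  rewrite inE => /orP[|]; last by rewrite inE; apply: far.
  rewrite inE => /andP[yNR _]; apply/negP => /Rnbr[c cC gyc].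
  by move: (far y c yNR gyc); rewrite subCR.
have : \sum_v0 deg g v0 + 2 * (#|Y| * #|C|.-1) + n <= n * n.
  apply: nonedge_count => [|y yY].
    by apply/pred0P => y /=; apply/negP => /andP[/sparse + /subCR]; move/negP.
  by have := sparse y yY; rewrite inE; lia.
(* The count now bounds the degree sum by [(n-1)(n-2D-1)], contradicting [degs]. *)
have c1 : n.-1 <= 2 * #|C|.-1 by lia.
have : (2 * D + 1) * n.-1 <= 2 * (#|Y| * #|C|.-1) by nia.
nia.
Qed.

End Graph.

(** * From a large signless Laplacian eigenvalue to many edges *)

Lemma adj_sum_deg (R : realType) (n : nat) (g : rel 'I_n) v :
  (\sum_w (g v w)%:R = (deg g v)%:R :> R)%R.
Proof.
rewrite -natr_sum; congr (_%:R)%R; rewrite /deg -sum1_card [RHS]big_mkcond.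
by apply: eq_bigr => w _; rewrite inE; case: (g v w).
Qed.

Lemma signlessQ_mulE (R : realType) (n : nat) (g : rel 'I_n) (x : 'rV[R]_n) v :
  symmetric g ->
  ((x *m signlessQ R g) 0 v = (deg g v)%:R * x 0 v + \sum_w (g v w)%:R * x 0 w)%R.
Proof.
move=> gS; rewrite mxE addrC.
have -> : ((deg g v)%:R * x 0 v = \sum_w (w == v)%:R * ((deg g w)%:R * x 0 w) :> R)%R.
  rewrite (bigD1 v) //= eqxx mul1r big1 ?addr0 // => w /negPf->.
  by rewrite mul0r.
by rewrite -big_split; apply: eq_bigr => w _; rewrite !mxE gS /=; ring.
Qed.

(** Divided by the degree of [v], the bound is that degree plus the mean degree of its neighbours.
    The vertex maximises [|x_v| / deg v] for an eigenvector [x]. *)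
Lemma signless_eigenvalue_le (R : realType) (n : nat) (g : rel 'I_n) (r : R) :
  symmetric g -> (forall v, 0 < deg g v) -> eigenvalue (signlessQ R g) r ->
  exists v, (r * (deg g v)%:R <= (deg g v)%:R ^+ 2 + \sum_w (g v w)%:R * (deg g w)%:R)%R.
Proof.
move=> gS dpos /eigenvalueP[x xQ x0].
have [i xi] : exists i, x 0%R i != 0%R.
  apply/existsP; rewrite -negb_forall; apply: contra x0 => /forallP x0.
  by apply/eqP/rowP => i; rewrite mxE; apply/eqP/x0.
pose f w := (`|x 0 w| / (deg g w)%:R)%R.
have [v _ vmax] := @arg_maxP _ _ _ i xpredT f isT.
exists v; have dR w : (0 < (deg g w)%:R :> R)%R by rewrite ltr0n.
have le_t w : (`|x 0 w| <= f v * (deg g w)%:R)%R by rewrite -ler_pdivrMr //; apply: vmax.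
have xv : (`|x 0 v| = f v * (deg g v)%:R)%R by rewrite divfK // gt_eqF.
have t0 : (0 < f v)%R.
  by apply: lt_le_trans (vmax i isT); rewrite divr_gt0 // normr_gt0.
move: (f v) le_t xv t0 => t le_t xv t0.
have := congr1 (fun y : 'rV_n => y 0%R v) xQ; rewrite signlessQ_mulE // mxE => eqv.
have : (r * `|x 0 v| <= (deg g v)%:R * `|x 0 v| + \sum_w (g v w)%:R * (t * (deg g w)%:R))%R.
  apply: (@le_trans _ _ (`|r * x 0 v|)%R).
    by rewrite normrM ler_wpM2r // ler_norm.
  rewrite -eqv; apply: (le_trans (ler_normD _ _)).
  rewrite normrM normr_nat lerD2l; apply: (le_trans (ler_norm_sum _ _ _)).
  by apply: ler_sum => w _; rewrite normrM normr_nat ler_wpM2l.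
rewrite xv => H; rewrite -(ler_pM2l t0); apply: le_trans (le_trans _ H) _.
  by rewrite le_eqVlt; apply/orP; left; apply/eqP; ring.
rewrite mulrDr lerD //; first by rewrite le_eqVlt; apply/orP; left; apply/eqP; ring.
rewrite mulr_sumr ler_sum // => w _.
by rewrite le_eqVlt; apply/orP; left; apply/eqP; ring.
Qed.

Lemma dense_of_signless_eigenvalue (R : realType) (n D : nat) (g : rel 'I_n) (r : R) :
  symmetric g -> irreflexive g -> (forall v, 0 < deg g v) -> 2 * D + 1 < n ->
  eigenvalue (signlessQ R g) r -> ((2 * (n - D.+1))%:R <= r)%R ->
  n.-1 * (n - 2 * D) <= \sum_v deg g v.
Proof.
move=> gS gI dpos nD /signless_eigenvalue_le[] // v + rD.
have deg_sum w : deg g w = \sum_x g w x.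
  rewrite /deg -sum1_card big_mkcond; apply: eq_bigr => x _.
  by rewrite inE; case: (g w x).
have -> : (\sum_w (g v w)%:R * (deg g w)%:R = (\sum_w g v w * deg g w)%:R :> R)%R.
  by rewrite natr_sum; apply: eq_bigr => w _; rewrite natrM.
have deg_le w : deg g w <= n.-1.
  have : #|[set x | g w x]| <= #|[set~ w]|.
    apply/subset_leq_card/subsetP => x; rewrite !inE.
    by apply: contraTneq => ->; rewrite gI.
  by rewrite cardsC1 card_ord.
have sum_le : \sum_w g v w * deg g w <= deg g v * n.-1.
  rewrite [deg g v]deg_sum big_distrl; apply: leq_sum => w _.
  by rewrite leq_mul2l deg_le orbT.
(* Beyond the degrees of its neighbours, [v] contributes its own degree, and each other
   non-neighbour at least 1. *)
have sum_le2 : \sum_w g v w * deg g w + n.-1 <= \sum_w deg g w.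
  have -> : n.-1 = deg g v + \sum_(w | w != v) ~~ g v w.
    rewrite deg_sum (bigD1 v) //= gI add0n -big_split /=.
    rewrite (eq_bigr (fun=> 1)) => [|w _]; last by case: (g v w).
    by rewrite sum1_card -[in LHS](card_ord n) -(cardsC1 v); apply: eq_card => w; rewrite !inE.
  rewrite addnCA (bigD1 v) //= gI mul0n add0n -big_split /= [leqRHS](bigD1 v) //= leq_add2l.
  by apply: leq_sum => w _; have := dpos w; case: (g v w) => /=; lia.
move=> Hv; have {Hv} : (2 * (n - D.+1) * deg g v <= deg g v ^ 2 + \sum_w g v w * deg g w)%N.
  rewrite -(ler_nat R) natrD natrM natrX; apply: le_trans Hv.
  by rewrite ler_wpM2r.
have := deg_le v; have := dpos v.
move: (deg g v) (\sum_w _) (\sum_w _) sum_le sum_le2 => d s m sm1 sm2 d0 dn ineq.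
rewrite leqNgt; apply/negP => small.
(* The concave function [2(n-D-1)d - d^2] equals [(n-1)(n-2D-1)] at both [d = n-2D-1] and [d = n-1].
   Since [s] is smaller, [d] lies below this interval, whereas [s <= d(n-1)] forces
   [d >= n-2D-1]. *)
have s_small : s < n.-1 * (n - 2 * D - 1) by nia.
have : d < n - 2 * D - 1 by nia.
nia.
Qed.

(** * A large eigenvalue of the extremal graph *)

(** The weight [h] is arbitrary so that constant weight 1 yields the degrees and the eigenvector
    yields the adjacency terms. *)
Lemma extremal_nbr_sum (R : realType) (n d : nat) (h : 'I_n -> R) (v : 'I_n) :
  let k := n - d + 1 in d <= k ->
  (\sum_w (extremal_graph n d v w)%:R * h w =
    if (v < d)%N then \sum_w h w - h v
    else if (v < k)%N then \sum_(w < n) (w < k)%N%:R * h w - h v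
    else \sum_(w < n) (w < d)%N%:R * h w)%R.
Proof.
move=> k dk; have hv : (h v = \sum_w (w == v)%:R * h w)%R.
  rewrite (bigD1 v) //= eqxx mul1r big1 ?addr0 // => w /negPf->.
  by rewrite mul0r.
rewrite /extremal_graph -/k.
case: (ltnP v d) => vd; last case: (ltnP v k) => vk.
- rewrite hv -sumrB; apply: eq_bigr => w _; rewrite andbT eq_sym.
  by case: (w == v); rewrite /= ?mul0r ?mul1r ?subr0 ?subrr.
- rewrite hv -sumrB; apply: eq_bigr => w _; rewrite /= eq_sym.
  have [->|_] := eqVneq w v; first by rewrite vk mul0r subrr.
  rewrite mul0r subr0; case: (ltnP w d) => // wd; by rewrite (leq_trans wd dk).
- apply: eq_bigr => w _; rewrite /= orbF; have [<-|//] := eqVneq v w.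
  by rewrite ltnNge vd.
Qed.

Lemma sum_ltn (R : realType) (n a : nat) : a <= n -> (\sum_(w < n) (w < a)%N%:R = a%:R :> R)%R.
Proof.
move=> an; rewrite -natr_sum -[in RHS](card_ord a) -sum1_card; congr (_%:R)%R.
rewrite (big_ord_widen n (fun=> 1)) // [RHS]big_mkcond.
by apply: eq_bigr => i _; case: ifP.
Qed.

(* The eigenvector takes the value x on K_d, y on the clique of order n - 2d + 1
   and z on the independent vertices; eliminating y and z from the eigenvalue
   equations leaves the cubic p. *)
Lemma extremal_eigenvalue (R : realType) (n d : nat) : 2 <= d -> 2 * d < n ->
  exists2 e : R, eigenvalue (signlessQ R (extremal_graph n d)) e & ((2 * (n - d))%:R <= e)%R.
Proof.
move=> d2 dn; pose N : R := n%:R%R; pose E : R := d%:R%R.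
have E2 : (2 <= E)%R by rewrite /E ler_nat.
have NE : (2 * E + 1 <= N)%R by rewrite /N /E -natrM natr1 ler_nat.
pose p : {poly R} := (('X - (N + E - 2)%:P) * ('X - (2 * N - 3 * E)%:P) * ('X - E%:P)
   - ((N - 2 * E + 1) * E)%:P * ('X - E%:P)
   - ((E - 1) * E)%:P * ('X - (2 * N - 3 * E)%:P))%R.
have pE l : (p.[l] = (l - (N + E - 2)) * (l - (2 * N - 3 * E)) * (l - E)
   - (N - 2 * E + 1) * E * (l - E) - (E - 1) * E * (l - (2 * N - 3 * E)))%R.
  by rewrite /p !hornerE.
(* The value of [p] is at most 0 at [2N - 2E], the largest eigenvalue for the clique of order
   [n - d + 1], and at least 0 at [2N]. *)
have [l /andP[l_ge _]] : exists2 l, (2 * N - 2 * E <= l <= 2 * N)%R & root p l.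
  apply: poly_ivt; first by lra.
  rewrite !pE; apply/andP; split; rewrite -subr_ge0.
    rewrite [X in (0 <= X)%R](_ : _ = (E - 1) * E * (2 * N - 2 * E))%R; last by ring.
    by rewrite !mulr_ge0 //; lra.
  rewrite [X in (0 <= X)%R](_ : _ = E * ((2 * N - E) * (2 * N - E + 5) - 3 * E * (E - 1)))%R; last by ring.
  by apply: mulr_ge0; [lra | nra].
rewrite rootE pE => /eqP pl.
have dle : ((2 * (n - d))%:R = 2 * N - 2 * E :> R)%R.
  by rewrite natrM natrB /N /E; [ring | lia].
exists l; last by rewrite dle.
pose k := n - d + 1.
have dk : d <= k by rewrite /k; lia.
have kn : k <= n by rewrite /k; lia.
have kE : (k%:R = N - E + 1 :> R)%R by rewrite /k natrD natrB /N /E //; lia.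
pose f (x y z : R) (w : 'I_n) : R := (z + (y - z) * (w < k)%N%:R + (x - y) * (w < d)%N%:R)%R.
have ltdk (w : 'I_n) : (w < d) -> (w < k) by move=> wd; apply: leq_trans wd dk.
have sum_f x y z : (\sum_w f x y z w = N * z + (y - z) * (N - E + 1) + (x - y) * E)%R.
  rewrite !big_split /= -!mulr_sumr !sum_ltn //; last lia.
  by rewrite kE sumr_const card_ord -[(z *+ n)%R]mulr_natl.
have sum_fk x y z : (\sum_(w < n) (w < k)%N%:R * f x y z w = y * (N - E + 1) + (x - y) * E)%R.
  rewrite -kE -(sum_ltn R kn) /E -(sum_ltn R (leq_trans dk kn)) !mulr_sumr -big_split.
  apply: eq_bigr => w _; rewrite /f /=; have := ltdk w.
  by case: (w < d) => [->//|_]; case: (w < k) => /=; ring.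
have sum_fd x y z : (\sum_(w < n) (w < d)%N%:R * f x y z w = x * E)%R.
  rewrite /E -(sum_ltn R (leq_trans dk kn)) !mulr_sumr.
  apply: eq_bigr => w _; rewrite /f /=; have := ltdk w.
  by case: (w < d) => [->//|_] /=; ring.
(* With denominators cleared, the equations for [y] and [z] hold identically, and the one for [x]
   becomes [p.[l] = 0]. *)
pose x := ((l - (2 * N - 3 * E)) * (l - E))%R.
pose y := (E * (l - E))%R.
pose z := (E * (l - (2 * N - 3 * E)))%R.
have gS : symmetric (extremal_graph n d).
  by move=> i j; rewrite /extremal_graph eq_sym orbCA [(_ < _) && _]andbC.
apply/eigenvalueP; exists (\row_w f x y z w)%R; last first.
  (* Vertex [d] is the first one of the second clique; its entry is [y], positive because
     [l > E]. *)
  have d_lt : d < n by lia.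
  apply/eqP => /rowP/(_ (Ordinal d_lt)); rewrite !mxE /f /= ltnn.
  have -> : d < k by rewrite /k; lia.
  rewrite mulr0 mulr1 addr0 addrC subrK => y0.
  by have : (0 < y)%R; [apply: mulr_gt0; lra | rewrite y0 ltxx].
apply/rowP => v.
have sum1 a : (a <= n)%N -> (\sum_(w < n) (w < a)%N%:R * 1 = a%:R :> R)%R.
  by move=> an; rewrite -(sum_ltn R an); apply: eq_bigr => w _; rewrite mulr1.
have degE : ((deg (extremal_graph n d) v)%:R =
    if (v < d)%N then N - 1 else if (v < k)%N then N - E else E :> R)%R.
  rewrite -adj_sum_deg.
  rewrite (eq_bigr (fun w => (extremal_graph n d v w)%:R * 1)%R) => [|w _]; last by rewrite mulr1.
  rewrite (extremal_nbr_sum (fun=> 1%R)) // !sum1 // ?(leq_trans dk) // kE addrK.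
  by rewrite sumr_const card_ord.
rewrite signlessQ_mulE // degE.
rewrite (eq_bigr (fun w => (extremal_graph n d v w)%:R * f x y z w)%R) => [|w _]; last by rewrite mxE.
rewrite extremal_nbr_sum // -/k sum_f sum_fk sum_fd !mxE /f; have := ltdk v.
case: (v < d) => [->//|_]; last case: (v < k).
- rewrite /= /x /y /z !mulr1; apply: subr0_eq; rewrite -[RHS]oppr0 -[in RHS]pl; ring.
- by rewrite /= /x /y /z mulr1 mulr0; ring.
- by rewrite /= /x /y /z !mulr0; ring.
Qed.

Theorem theorem1p1 (R : realType) (n delta : nat) (g : rel 'I_n)
  (rG rH : R) :
  (2 <= delta)%N ->
  simple_graph g ->
  connected_graph g ->
  ~~ odd n ->
  min_degree g delta ->
  (7 * delta - 7 <= n)%N ->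
  (delta ^ 2 + 2 * delta + 24 <= 4 * n)%N ->
  is_rhoQ g rG ->
  is_rhoQ (extremal_graph n delta) rH ->
  (rH <= rG)%R ->
  has_even_factor g \/ isomorphic g (extremal_graph n delta).
Proof.
move=> d2 [gS gI] _ _ [_ mindeg] n7 n4 [eigG _] [_ maxH] rHG; left.
(* For [delta = 2] the quadratic bound already reads [32 <= 4n]. *)
have n8 : 8 <= n by nia.
have [||e eigH e_ge] := @extremal_eigenvalue R n delta; [exact: d2 | lia |].
have rG_ge : ((2 * (n - delta.-1.+1))%:R <= rG)%R.
  by rewrite prednK ?(ltnW d2) //; apply: le_trans e_ge (le_trans (maxH e eigH) rHG).
have degD v : delta.-1 < deg g v by have := mindeg v; lia.
apply: (@even_factor_of_dense _ _ gS gI delta.-1) => //; try lia.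
apply: (dense_of_signless_eigenvalue gS gI _ _ eigG rG_ge); last lia.
by move=> v; apply: leq_ltn_trans (degD v).
Qed.
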